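(* Let $(X,T)$ be a Polish dynamical system. The irregular set $I(X,T)$ is a $\boldsymbol{\Sigma}^0_3$ set and the quasi-regular set $Q(X,T)=X\setminus I(X,T)$ is a $\boldsymbol{\Pi}^0_3$ set.
   Context: A Polish dynamical system $(X,T)$ is a Polish space $X$ (not assumed compact) with a continuous map $T\colon X\to X$. For bounded continuous $\varphi\colon X\to\mathbb{R}$, $A_k\varphi(x)=\frac1k\sum_{j=0}^{k-1}\varphi(T^j(x))$ for $k\ge1$, and $I_\varphi(X,T)$ is the set of $x\in X$ for which $(A_k\varphi(x))_{k\ge1}$ does not converge. $I(X,T)$ is the union of $I_\varphi(X,T)$ over all bounded continuous $\varphi\colon X\to\mathbb{R}$. $\boldsymbol{\Sigma}^0_3$ sets are the countable unions of $G_\delta$ sets; $\boldsymbol{\Pi}^0_3$ sets are the countable intersections of $F_\sigma$ sets. *)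

(* Defs.v *)
From mathcomp Require Import all_boot all_order all_algebra.
From mathcomp Require Import boolp classical_sets functions cardinality reals.
From mathcomp Require Import topology normedtype sequences borel_hierarchy.

Set Implicit Arguments.
Unset Strict Implicit.
Unset Printing Implicit Defensive.

Import Order.TTheory GRing.Theory Num.Theory.
Import numFieldNormedType.Exports.

Local Open Scope classical_set_scope.
Local Open Scope ring_scope.

Definition separable (X : topologicalType) : Prop :=
  exists2 D : set X, countable D & dense D.

Definition is_metric (R : realType) (X : Type) (d : X -> X -> R) : Prop :=
  [/\ forall x y, 0 <= d x y,
      forall x y, d x y = 0 <-> x = y,
      forall x y, d x y = d y x
    & forall x y z, d x z <= d x y + d y z].

Definition metrizes (R : realType) (X : topologicalType) (d : X -> X -> R) :
    Prop :=
  forall A : set X, open A <->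
    forall x, A x -> exists2 e : R, 0 < e & [set y | d x y < e] `<=` A.

Definition metric_cauchy (R : realType) (X : Type) (d : X -> X -> R)
    (u : nat -> X) : Prop :=
  forall e : R, 0 < e -> exists N : nat, forall m n : nat,
    (N <= m)%N -> (N <= n)%N -> d (u m) (u n) < e.

Definition completely_metrizable (R : realType) (X : topologicalType) : Prop :=
  exists d : X -> X -> R,
    [/\ is_metric d, metrizes d
      & forall u : nat -> X, metric_cauchy d u -> exists l : X, u @ \oo --> l].

Definition polish_space (R : realType) (X : topologicalType) : Prop :=
  separable X /\ completely_metrizable R X.

Definition Sigma03 (X : topologicalType) (S : set X) : Prop :=
  exists2 F : nat -> set X, (forall i, Gdelta (F i)) & S = \bigcup_i F i.

Definition Pi03 (X : topologicalType) (S : set X) : Prop :=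
  exists2 F : nat -> set X, (forall i, Fsigma (F i)) & S = \bigcap_i F i.

Section irregular.
Variables (R : realType) (X : topologicalType) (T : X -> X).

(* The junk value at [k = 0] is irrelevant to convergence as [k] tends to
   infinity. *)
Definition birkhoff_average (phi : X -> R) (k : nat) (x : X) : R :=
  k%:R^-1 * \sum_(j < k) phi (iter j T x).

Definition irregular_for (phi : X -> R) : set X :=
  [set x | ~ cvgn (fun k => birkhoff_average phi k x)].

Definition irregular_set : set X :=
  \bigcup_(phi in [set phi : X -> R | bounded_fun phi /\ continuous phi])
    irregular_for phi.

Definition quasi_regular_set : set X := ~` irregular_set.

End irregular.

(* Main.v *)
(* Averages along the orbit of x are integrals against empirical measures. The
   point x is quasi-regular iff these measures are tight and the averages of
   countably many bump functions converge; with a dense sequence q, tightness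
   reads: for all m there is n such that at all times the mass outside the
   2^-m-neighbourhood of q_0, ..., q_(n-1) is at most 2^-m. After smoothing the
   indicator functions these conditions are Pi^0_3.

   Tightness is necessary by a gliding hump argument: if mass escapes from all
   finite unions of balls, then some locally finite sum of humps is a bounded
   continuous function whose averages oscillate. Conversely, tightness puts most
   of the mass on a compact set, where a bounded continuous function is uniformly
   close to a linear combination of a partition of unity made of bumps. *)

Require Import Defs.
From mathcomp Require Import all_boot all_order all_algebra.
From mathcomp Require Import boolp classical_sets functions cardinality reals.
From mathcomp Require Import topology normedtype sequences borel_hierarchy.
From mathcomp Require Import lra.

Set Implicit Arguments.
Unset Strict Implicit.
Unset Printing Implicit Defensive.

Import Order.TTheory GRing.Theory Num.Theory.
Import numFieldNormedType.Exports.

Local Open Scope classical_set_scope.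
Local Open Scope ring_scope.

(** * Birkhoff averages along an orbit *)

Section birkhoff_average_theory.
Variables (R : realType) (X : topologicalType) (T : X -> X).
Implicit Types (f g : X -> R) (k : nat) (x : X).
Local Notation A := (birkhoff_average T).

Lemma ler_birkhoff f g k x :
  (forall j, (j < k)%N -> f (iter j T x) <= g (iter j T x)) -> A f k x <= A g k x.
Proof.
by move=> fg; apply: ler_wpM2l; rewrite ?invr_ge0// ler_sum// => j _; exact: fg.
Qed.

Lemma birkhoffD f g k x : A (fun y => f y + g y) k x = A f k x + A g k x.
Proof. by rewrite /birkhoff_average big_split mulrDr. Qed.

Lemma birkhoffB f g k x : A (fun y => f y - g y) k x = A f k x - A g k x.
Proof. by rewrite /birkhoff_average sumrB mulrBr. Qed.

Lemma birkhoffZ (c : R) f k x : A (fun y => c * f y) k x = c * A f k x.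
Proof. by rewrite /birkhoff_average -mulr_sumr mulrCA. Qed.

Lemma birkhoff_sum (I : Type) (r : seq I) (P : pred I) (f : I -> X -> R) k x :
  A (fun y => \sum_(i <- r | P i) f i y) k x = \sum_(i <- r | P i) A (f i) k x.
Proof. by rewrite /birkhoff_average exchange_big mulr_sumr. Qed.

Lemma birkhoff0 f k x :
  (forall j, (j < k)%N -> f (iter j T x) = 0) -> A f k x = 0.
Proof. by move=> f0; rewrite /birkhoff_average big1 ?mulr0// => j _; exact: f0. Qed.

Lemma birkhoff_le_cst (c : R) f k x : 0 <= c ->
  (forall j, (j < k)%N -> f (iter j T x) <= c) -> A f k x <= c.
Proof.
case: k => [|k] c0 fc; first by rewrite /birkhoff_average big_ord0 mulr0.
rewrite /birkhoff_average ler_pdivrMl ?ltr0Sn// mulr_natl.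
apply: (@le_trans _ _ (\sum_(j < k.+1) c)); first by apply: ler_sum => j _; exact: fc.
by rewrite sumr_const card_ord.
Qed.

Lemma ler_norm_birkhoff f k x : `|A f k x| <= A (fun y => `|f y|) k x.
Proof.
rewrite /birkhoff_average normrM ger0_norm ?invr_ge0//.
by rewrite ler_wpM2l ?invr_ge0// ler_norm_sum.
Qed.

Lemma continuous_birkhoff f k : continuous T -> continuous f ->
  continuous (A f k).
Proof.
move=> cT cf; have citer j : continuous (fun x => iter j T x).
  elim: j => [|j IH] x; first exact: cvg_id.
  by apply: (@continuous_comp _ _ _ (iter j T) T); [exact: IH|exact: cT].
move=> x; apply: cvgM; first exact: cvg_cst.
apply: (@continuous_big _ _ +%R 0 xpredT) => [xy|j _ y]; last first.
  by apply: (@continuous_comp _ _ _ (fun x => iter j T x) f); [exact: citer|exact: cf].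
exact: add_continuous.
Qed.

End birkhoff_average_theory.

(** * Boundedness and the Cauchy criterion *)

Lemma bounded_fun_le (R : realType) (X : topologicalType) (f : X -> R) (c : R) :
  (forall x, `|f x| <= c) -> bounded_fun f.
Proof.
move=> fc; exists c; split => [|y cy x _]; first exact: num_real.
exact: (le_trans (fc x) (ltW cy)).
Qed.

Lemma bounded_fun_ex (R : realType) (X : topologicalType) (f : X -> R) :
  bounded_fun f -> exists2 c : R, 0 < c & forall x, `|f x| <= c.
Proof.
move=> [M [_ Mf]]; exists (`|M| + 1); first by rewrite ltr_wpDl.
by move=> x; apply: Mf => //; rewrite ltr_pwDr// ler_norm.
Qed.

(** The non-strict bound makes each pair [k], [l] a closed condition when the terms depend
    continuously on a point. *)
Lemma cvgn_cauchyP (R : realType) (u : nat -> R) :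
  cvgn u <-> forall e : R, 0 < e ->
    exists N, forall k l, (N <= k)%N -> (N <= l)%N -> `|u k - u l| <= e.
Proof.
split=> [/cvg_ex[l ul] e e0|uc].
  have e20 : 0 < e / 2 by rewrite divr_gt0.
  have [N _ HN] := cvgr_dist_le _ _ ul _ e20.
  exists N => k m /HN Hk /HN Hm; rewrite /= in Hk Hm.
  rewrite (splitr e); apply: le_trans (ler_distD l _ _) _.
  by rewrite lerD// distrC.
apply/cauchy_cvgP/cauchyP => e e0.
have e20 : 0 < e / 2 by rewrite divr_gt0.
have [N HN] := uc _ e20.
exists (u N), N => // k /= Nk; rewrite /ball/=.
by apply: le_lt_trans (HN _ _ _ _) _ => //; rewrite ltr_pdivrMr// ltr_pMr// ltr1n.
Qed.

(** * Gliding humps: convergence of averages prevents escape of mass *)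

Section gliding_hump.
Variables (R : realType) (X : topologicalType) (T : X -> X) (h : nat -> X -> R).
Hypothesis h_cont : forall n, continuous (h n).
Hypothesis h_le1 : forall n y, h n y <= 1.
Hypothesis h_mono : forall m n y, (m <= n)%N -> h n y <= h m y.
Hypothesis h_loc0 :
  forall y : X, exists N, \forall z \near y, forall n, (N <= n)%N -> h n z = 0.
Local Notation A := (birkhoff_average T).

(** A sigma type, so that the bound can serve as the length of a pointwise finite sum. *)
Let vanish y : {N | forall n, (N <= n)%N -> h n y = 0}.
Proof.
apply: cid; have [N yN] := h_loc0 y; exists N; exact: nbhs_singleton yN.
Qed.

Let orbit_vanish x k : exists N, forall n j, (N <= n)%N -> (j < k)%N ->
  h n (iter j T x) = 0.
Proof.
exists (\max_(j < k) sval (vanish (iter j T x))) => n j Nn jk.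
apply: (svalP (vanish _)); apply: leq_trans Nn.
exact: (leq_bigmax (Ordinal jk)).
Qed.

(** Before time [K] the orbit visits finitely many points, where [h n] vanishes for large [n]; mass
    seen by such an [h n] is seen no earlier than [K], and [h] decreases in [n]. *)
Lemma escaping_mass_late x (e : R) : 0 < e ->
  (forall n, exists k, e < A (h n) k x) ->
  forall n K, exists2 k, (K <= k)%N & e < A (h n) k x.
Proof.
move=> e0 esc n K; have [N HN] := orbit_vanish x K.
have [k ek] := esc (maxn n N); exists k.
  rewrite leqNgt; apply/negP => kK; move: ek.
  rewrite birkhoff0 ?ltNge ?(ltW e0)// => j jk.
  by apply: HN; rewrite ?leq_maxr// (ltn_trans jk).
apply: lt_le_trans ek _; apply: ler_birkhoff => j _.
by apply: h_mono; rewrite leq_maxl.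
Qed.

(* Cutting [h n] into two interlaced trains of humps, each of which carries mass
   more than [e] at infinitely many times and hence has limit average at least
   [e], shows that the limit average of [h n] is at least [2 * e]; any factor in
   ]1, 2[ would do in the conclusion. *)
Lemma escaping_mass_amplify x (e : R) : 0 < e ->
  (forall phi : X -> R, bounded_fun phi -> continuous phi ->
     cvgn (fun k => A phi k x)) ->
  (forall n, exists k, e < A (h n) k x) ->
  forall n, exists k, 3 / 2 * e < A (h n) k x.
Proof.
move=> e0 cvgA esc n0.
(* [G n] is so large that [h (G n)] vanishes along the orbit before time [k]; subtracting it leaves
   the average of [h n] at time [k] unchanged. *)
have /choice[G GP] n : exists n', (n < n')%N /\
    exists2 k, (n <= k)%N & e < A (fun y => h n y - h n' y) k x.
  have [k nk ek] := escaping_mass_late e0 esc n n.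
  have [N HN] := orbit_vanish x k.
  exists (maxn n.+1 N); split; first by rewrite leq_maxl.
  exists k => //; rewrite birkhoffB [X in _ - X]birkhoff0 ?subr0// => j jk.
  by apply: HN => //; rewrite leq_maxr.
pose ns s := iter s G n0.
have ns_ge s : (s <= ns s)%N.
  by elim: s => // s IH; rewrite /ns iterS; apply: leq_ltn_trans IH (GP _).1.
pose t s y := h (ns s) y - h (ns s.+1) y.
have t_ge0 s y : 0 <= t s y by rewrite subr_ge0 h_mono// ltnW// (GP (ns s)).1.
have t0 N s y : (forall n, (N <= n)%N -> h n y = 0) -> (N <= s)%N -> t s y = 0.
  move=> h0 Ns; rewrite /t !h0 ?subrr// ?(leq_trans Ns)//.
  by rewrite (leq_trans _ (ns_ge _)).
pose S (b : bool) m y := \sum_(s < m | odd s == b) t s y.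
have S_stable b N m y : (forall n, (N <= n)%N -> h n y = 0) -> (N <= m)%N ->
    S b m y = S b N y.
  move=> h0 Nm; rewrite /S -!(big_mkord (fun s => odd s == b) (t^~ y)).
  rewrite (big_cat_nat (n := N))//= [X in _ + X]big_nat_cond [X in _ + X]big1 ?addr0//.
  by move=> s /andP[/andP[Ns _] _]; exact: t0 Ns.
(* The sum of all humps of parity [b], cut at a point-dependent index past which every term
   vanishes; by [phiE] any such index gives the same value. *)
pose phi (b : bool) y := S b (sval (vanish y)) y.
have phiE b N y : (forall n, (N <= n)%N -> h n y = 0) -> phi b y = S b N y.
  move=> h0; rewrite /phi; case: (vanish y) => M hM /=.
  by rewrite -(S_stable b M (maxn M N))// ?leq_maxl// (S_stable b N)// leq_maxr.
have phi_ge0 b y : 0 <= phi b y by apply: sumr_ge0 => s _; exact: t_ge0.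
(* The humps of both parities telescope to [h n0 - h (ns m)], whose second term vanishes at [y] for
   large [m]. *)
have phiD y : phi true y + phi false y = h n0 y.
  rewrite /phi /S; case: (vanish y) => M hM /=.
  have tE m : \sum_(s < m) t s y = h n0 y - h (ns m) y.
    elim: m => [|m IH]; first by rewrite big_ord0 subrr.
    by rewrite big_ord_recr/= IH /t addrA subrK.
  transitivity (\sum_(s < M) t s y); last by rewrite tE (hM (ns M)) ?subr0.
  rewrite [RHS](bigID (fun s : 'I_M => odd s == true))/=; congr (_ + _).
  by apply: eq_bigl => s; case: (odd s).
have phi_le1 b y : phi b y <= 1.
  by apply: le_trans (h_le1 n0 y); rewrite -phiD; case: b; rewrite ?lerDl ?lerDr.
(* Near [y] one index [N] serves all points, so [phi b] is locally the finite sum [S b N]. *)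
have phi_cont b : continuous (phi b).
  move=> y; have [N yN] := h_loc0 y.
  have S_cont : continuous (S b N).
    move=> z; apply: (@continuous_big _ _ +%R 0) => [xy|s _ w].
      exact: add_continuous.
    by apply: cvgB; exact: h_cont.
  rewrite /continuous_at (phiE b N y (nbhs_singleton yN)).
  apply: cvg_trans (S_cont y); apply: near_eq_cvg.
  by near=> z; apply/esym/phiE; near: z.
have phi_cvg b : cvgn (fun k => A (phi b) k x).
  apply: cvgA => //; apply: (@bounded_fun_le _ _ _ 1) => y.
  by rewrite ger0_norm.
have phi_ge_t b s y : odd s == b -> t s y <= phi b y.
  move=> sb; rewrite /phi; case: (vanish y) => M hM /=.
  have [Ms|sM] := leqP M s.
    by rewrite (t0 M)// /S sumr_ge0.
  by rewrite /S (bigD1 (Ordinal sM))//= lerDl sumr_ge0.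
have phi_late b K : exists2 k, (K <= k)%N & e < A (phi b) k x.
  pose s := (K.*2 + b)%N.
  have [_ [k nk ek]] := GP (ns s); exists k.
    apply: leq_trans nk; apply: leq_trans (ns_ge _).
    by rewrite /s -addnn -addnA leq_addr.
  apply: lt_le_trans ek _; apply: ler_birkhoff => j _.
  by apply: phi_ge_t; rewrite oddD odd_double oddb.
(* Late averages differ by at most [e / 8] and exceed [e] at some late time, so they stay above
   [7 / 8 * e]; two trains at [3 / 4 * e] give [3 / 2 * e]. *)
have phi_lim b : exists N, forall k, (N <= k)%N -> 4^-1 * 3 * e < A (phi b) k x.
  have e80 : 0 < e / 8 by rewrite divr_gt0.
  have [N HN] := (cvgn_cauchyP _).1 (phi_cvg b) _ e80.
  exists N => k Nk; have [l Nl el] := phi_late b N.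
  have := HN _ _ Nk Nl; rewrite ler_norml => /andP[+ _]; lra.
have [N HN] := phi_lim true; have [N' HN'] := phi_lim false.
exists (maxn N N').
have -> : h n0 = fun y => phi true y + phi false y by apply/funext => y; rewrite phiD.
have := HN _ (leq_maxl N N'); have := HN' _ (leq_maxr N N'); rewrite birkhoffD; lra.
Unshelve. all: by end_near. Qed.

(** Otherwise repeated amplification gives every [h n] averages above [(3 / 2) ^+ p * e] for all
    [p], against the bound 1. *)
Lemma no_escaping_mass x (e : R) : 0 < e ->
  (forall phi : X -> R, bounded_fun phi -> continuous phi ->
     cvgn (fun k => A phi k x)) ->
  exists n, forall k, A (h n) k x <= e.
Proof.
move=> e0 cvgA; apply: contrapT => noN.
have esc p : forall n, exists k, (3 / 2) ^+ p * e < A (h n) k x.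
  elim: p => [|p IH] n.
    rewrite expr0 mul1r; apply: contrapT => nok; apply: noN; exists n => k.
    by rewrite leNgt; apply/negP => ek; apply: nok; exists k.
  rewrite exprS -mulrA; apply: escaping_mass_amplify => //.
  by rewrite mulr_gt0// exprn_gt0// divr_gt0.
have pow p : p%:R / 2 <= (3 / 2) ^+ p :> R.
  elim: p => [|p IH]; first by rewrite mul0r expr0.
  rewrite exprS -natr1; have : (1 : R) <= (3 / 2) ^+ p by rewrite exprn_ege1//; lra.
  by move: IH; lra.
pose p := Num.bound (2 / e).
have [k ek] := esc p 0; have : A (h 0) k x <= 1 by exact: birkhoff_le_cst.
apply/negP; rewrite -ltNge; apply: le_lt_trans ek.
apply: le_trans (ler_wpM2r (ltW e0) (pow p)).
have : 2 / e < p%:R by apply: archi_boundP; rewrite divr_ge0// ltW.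
by rewrite ltr_pdivrMr// => /ltW; lra.
Qed.

End gliding_hump.

(** * Neighbourhoods and distance functions *)

Section metric_theory.
Variables (R : realType) (X : topologicalType) (d : X -> X -> R).
Hypotheses (d_metric : is_metric d) (d_top : metrizes d).

Lemma metrizes_nbhsP (x : X) (A : set X) :
  nbhs x A <-> exists2 e : R, 0 < e & [set y | d x y < e] `<=` A.
Proof.
have [_ d0 _ dD] := d_metric; split=> [|[e e0 eA]].
  rewrite nbhsE => -[B [oB Bx] BA].
  by have [e e0 eB] := (d_top B).1 oB x Bx; exists e => //; exact: subset_trans BA.
apply: filterS eA _; apply: open_nbhs_nbhs; split; last by rewrite /= (d0 x x).2.
apply/d_top => y /= xy; exists (e - d x y); first by rewrite subr_gt0.
by move=> z /= yz; apply: le_lt_trans (dD x y z) _; rewrite addrC -ltrBrDr.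
Qed.

Lemma continuous_dist (p : X) : continuous (fun x => d x p).
Proof.
have [_ _ dC dD] := d_metric.
move=> x; apply/cvgrPdist_lt => e e0; apply/metrizes_nbhsP; exists e => // y /= xy.
apply: le_lt_trans xy; rewrite ler_norml lerBrDr lerBlDr.
have := dD x y p; have := dD y x p; rewrite (dC y x); lra.
Qed.

End metric_theory.

(** * Uniform continuity near a totally bounded set *)

Section compactness.
Variables (R : realType) (X : topologicalType) (d : X -> X -> R).
Hypotheses (d_metric : is_metric d) (d_top : metrizes d).
Hypothesis d_complete :
  forall u : nat -> X, metric_cauchy d u -> exists l : X, u @ \oo --> l.
Variables (phi : X -> R) (e : R).
Hypotheses (phi_cont : continuous phi) (e_gt0 : 0 < e).

(** Only [x] is confined to [B]; [y] ranges over the whole space, because centres of bumps may lie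
    outside [B]. *)
Let good (B : set X) := exists2 r : R, 0 < r &
  forall x y, B x -> d x y < r -> `|phi x - phi y| <= e.

Let good_cover (B : set X) (C : nat -> set X) n :
  (forall i, (i < n)%N -> good (B `&` C i)) ->
  good (B `&` [set x | exists2 i, (i < n)%N & C i x]).
Proof.
elim: n => [|n IH] gC; first by exists 1 => // x y [_ []].
have [r r0 Hr] : good (B `&` [set x | exists2 i, (i < n)%N & C i x]).
  by apply: IH => i /ltnW; exact: gC.
have [s s0 Hs] := gC n (ltnSn n).
exists (Num.min r s); first by rewrite lt_min r0.
move=> x y [Bx [i + Cx]]; rewrite lt_min ltnS leq_eqVlt.
case/orP => [/eqP ein|ilt] /andP[xr xs].
  by apply: Hs => //; split => //; rewrite -ein.
by apply: Hr => //; split => //; exists i.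
Qed.

Lemma uniform_modulus (q : nat -> X) (N : nat -> nat) (a : nat -> R) :
  (forall b : R, 0 < b -> exists m0, forall m, (m0 <= m)%N -> a m < b) ->
  exists2 r : R, 0 < r & forall x y,
    (forall m, exists2 i, (i < N m)%N & d x (q i) < a m) ->
    d x y < r -> `|phi x - phi y| <= e.
Proof.
have [_ _ dC dD] := d_metric.
move=> a0; pose K := [set x | forall m, exists2 i, (i < N m)%N & d x (q i) < a m].
suff : good K by [].
(* As [good] is stable under finite unions, a bad [K] contains a decreasing
   sequence of bad sets of vanishing diameter, which shrinks to a point [l];
   continuity at [l] makes the small ones good. *)
apply: contrapT => badK.
pose cut B m i := B `&` [set x | d x (q i) < a m].
(* A bad subset of [K] has a bad piece, since finitely many balls of radius [a m] cover [K]; the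
   default 0 serves only for other [B]. *)
pose pick B m := xget 0%N [set i | ~ good (cut B m i)].
pose Bs := fix Bs m := if m is m'.+1 then cut (Bs m') m' (pick (Bs m') m') else K.
have BsK m : Bs m `<=` K by elim: m => [//|m IH] x [/IH].
have Bs_sub m n : (m <= n)%N -> Bs n `<=` Bs m.
  elim: n => [|n IH]; first by rewrite leqn0 => /eqP ->.
  by rewrite leq_eqVlt => /orP[/eqP ->//|mn] x [/(IH mn)].
have Bs_bad m : ~ good (Bs m).
  elim: m => [//|m IH] /=; apply: (@xgetPex _ 0%N [set i | ~ good (cut (Bs m) m i)]).
  apply: contrapT => nobad; apply: IH.
  have [|r r0 Hr] := @good_cover (Bs m) (fun i => [set x | d x (q i) < a m]) (N m).
    by move=> i _; apply: contrapT => badi; apply: nobad; exists i.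
  by exists r => // x y Bx xy; apply: Hr => //; split => //; exact: (BsK m x Bx m).
have Bs_diam m x y : Bs m.+1 x -> Bs m.+1 y -> d x y < 2 * a m.
  move=> [_ /= xq] [_ /= yq]; apply: le_lt_trans (dD x (q (pick (Bs m) m)) y) _.
  by rewrite mulr_natl mulr2n ltrD// dC.
(* Bad sets are inhabited because the empty set is good. *)
have /choice[z zB] m : exists z, Bs m z.
  apply: contrapT => noz; apply: (Bs_bad m); exists 1 => // x y Bx.
  by exfalso; apply: noz; exists x.
have small b : 0 < b -> exists m0, forall m, (m0 <= m)%N -> 2 * a m < b.
  move=> b0; have [m0 Hm0] := a0 _ (divr_gt0 b0 (ltr0n R 2)); exists m0 => m /Hm0.
  by rewrite ltr_pdivlMr// mulrC.
have [l zl] : exists l : X, z @ \oo --> l.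
  apply: d_complete => b /small[m0 Hm0]; exists m0.+1 => m n mm nn.
  by apply: lt_trans (Hm0 m0 (leqnn _)); apply: Bs_diam; apply: (Bs_sub m0.+1) (zB _).
have e20 : 0 < e / 2 by rewrite divr_gt0.
have /cvgrPdist_lt/(_ _ e20) := @phi_cont l.
move=> /(metrizes_nbhsP d_metric d_top) [b b0 Hb].
have [|n0 _ Hn0] := zl [set y | d l y < b / 4].
  by apply/(metrizes_nbhsP d_metric d_top); exists (b / 4); rewrite ?divr_gt0.
have [m0 Hm0] := small (b / 4) (divr_gt0 b0 (ltr0n R 4)).
pose m := maxn n0 m0.
(* [x] is within [b / 4 + b / 4] of [l] through [z m.+1], and [y] within [b / 2] of [x]; both lie in
   the ball where [phi] is [e / 2]-close to [phi l]. *)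
apply: (Bs_bad m.+1); exists (b / 2); first by rewrite divr_gt0.
move=> x y Bx xy.
have lz : d l (z m.+1) < b / 4 by apply: Hn0; rewrite /= leqW// leq_maxl.
have zx : d (z m.+1) x < b / 4.
  by apply: lt_trans (Bs_diam m _ _ (zB _) Bx) _; apply: Hm0; rewrite leq_maxr.
have lx : d l x < b / 2 by have := dD l (z m.+1) x; lra.
have Hx : `|phi l - phi x| < e / 2 by apply: Hb => /=; lra.
have Hy : `|phi l - phi y| < e / 2 by apply: Hb => /=; have := dD l x y; lra.
have := ler_distD (phi l) (phi x) (phi y); rewrite (distrC (phi x) (phi l)); lra.
Qed.

End compactness.

(** * Cut-off functions and partitions of unity *)

Section humps_and_bumps.
Variables (R : realType) (X : topologicalType) (d : X -> X -> R) (q : nat -> X).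
Hypotheses (d_metric : is_metric d) (d_top : metrizes d).
Implicit Types (r : R) (x : X).

(* 0 at points within [r] of one of [q 0, ..., q (n - 1)], 1 at points at
   distance at least [2 * r] from all of them. *)
Definition hump r n x : R :=
  \prod_(i < n) Num.max 0 (Num.min 1 (d x (q i) / r - 1)).

(** The radius [3 * r] makes the tent at least [r] within [2 * r] of [q i], where the maximum with
    [r] in [bump] is then inactive. *)
Definition tent r i x : R := Num.max 0 (3 * r - d x (q i)).

(* The [bump r n i] form a partition of unity on the [2 * r]-neighbourhood of
   [q 0, ..., q (n - 1)]; the maximum with [r] keeps the quotient continuous
   elsewhere. *)
Definition bump r n i x : R :=
  tent r i x / Num.max r (\sum_(i < n) tent r i x).

Lemma continuous_hump r n : continuous (hump r n).
Proof.
rewrite /hump; apply: (@continuous_big R _ *%R 1 xpredT) => [xy|i _]; first exact: mul_continuous.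
apply: max_fun_continuous => [y|]; first exact: cvg_cst.
apply: min_fun_continuous => y; first exact: cvg_cst.
apply: cvgB; last exact: cvg_cst.
by apply: cvgM; [exact: continuous_dist|exact: cvg_cst].
Qed.

Lemma continuous_tent r i : continuous (tent r i).
Proof.
apply: max_fun_continuous => y; first exact: cvg_cst.
by apply: cvgB; [exact: cvg_cst|exact: continuous_dist].
Qed.

Lemma continuous_bump r n i : 0 < r -> continuous (bump r n i).
Proof.
move=> r0 x; apply: cvgM; first exact: continuous_tent.
apply: cvgV; first by rewrite gt_eqF// lt_max r0.
apply: max_fun_continuous => [y|]; first exact: cvg_cst.
apply: (@continuous_big _ _ +%R 0) => [xy|j _]; first exact: add_continuous.
exact: continuous_tent.
Qed.

Let factor_ge0 (t : R) : 0 <= Num.max 0 (Num.min 1 t).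
Proof. by rewrite le_max lexx. Qed.

Let factor_le1 (t : R) : Num.max 0 (Num.min 1 t) <= 1.
Proof. by rewrite ge_max ler01 ge_min lexx. Qed.

Lemma hump_ge0 r n x : 0 <= hump r n x.
Proof. by apply: prodr_ge0. Qed.

Lemma hump_le1 r n x : hump r n x <= 1.
Proof. by apply: prodr_ile1 => i _; rewrite factor_ge0 factor_le1. Qed.

Lemma le_hump r m n x : (m <= n)%N -> hump r n x <= hump r m x.
Proof.
move=> /subnKC <-; elim: (n - m)%N => [|p IH]; first by rewrite addn0.
rewrite addnS /hump big_ord_recr/=; apply: le_trans IH.
by rewrite ler_piMr// hump_ge0.
Qed.

Lemma hump_eq1 r n x : 0 < r ->
  (forall i, (i < n)%N -> 2 * r <= d x (q i)) -> hump r n x = 1.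
Proof.
move=> r0 far; rewrite /hump big1// => i _; rewrite min_l ?max_r//.
by rewrite lerBrDr ler_pdivlMr// far.
Qed.

Lemma hump_eq0 r n i x : 0 < r -> (i < n)%N -> d x (q i) <= r -> hump r n x = 0.
Proof.
move=> r0 ltin xi; rewrite /hump (bigD1 (Ordinal ltin))//= max_l ?mul0r//.
by rewrite ge_min subr_le0 ler_pdivrMr// mul1r xi orbT.
Qed.

Lemma tent_ge0 r i x : 0 <= tent r i x.
Proof. by rewrite /tent le_max lexx. Qed.

Lemma bump_ge0 r n i x : 0 < r -> 0 <= bump r n i x.
Proof. by move=> r0; rewrite mulr_ge0 ?tent_ge0// invr_ge0 le_max ltW. Qed.

Lemma bump_neq0 r n i x : bump r n i x != 0 -> d x (q i) < 3 * r.
Proof.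
apply: contraNT; rewrite -leNgt /bump /tent => far.
by rewrite max_l ?mul0r// subr_le0.
Qed.

Lemma sum_bump_le1 r n x : 0 < r -> \sum_(i < n) bump r n i x <= 1.
Proof.
move=> r0; rewrite -mulr_suml ler_pdivrMr ?lt_max ?r0//.
by rewrite mul1r le_max lexx orbT.
Qed.

Lemma sum_bump_eq1 r n x : 0 < r ->
  (exists2 i, (i < n)%N & d x (q i) < 2 * r) -> \sum_(i < n) bump r n i x = 1.
Proof.
move=> r0 [i ltin xi]; rewrite -mulr_suml.
have ler : r <= \sum_(i < n) tent r i x.
  rewrite (bigD1 (Ordinal ltin))//=; apply: (@le_trans _ _ (tent r i x)).
    by rewrite /tent le_max; apply/orP; right; lra.
  by rewrite lerDl sumr_ge0// => j _; exact: tent_ge0.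
by rewrite max_r// divff// gt_eqF// (lt_le_trans r0).
Qed.

(** As [i] may be at least [n], the bound 1 on the sum does not apply; instead the numerator is at
    most [3 * r] and the denominator at least [r]. *)
Lemma bump_le3 r n i x : 0 < r -> bump r n i x <= 3.
Proof.
have [d_ge0 _ _ _] := d_metric.
move=> r0; rewrite ler_pdivrMr ?lt_max ?r0//; apply: (@le_trans _ _ (3 * r)).
  by rewrite /tent ge_max mulr_ge0 ?(ltW r0)//= lerBlDr lerDl.
by rewrite ler_pM2l// le_max lexx.
Qed.

(** Once [n] exceeds [i], the product has a factor vanishing on a ball about [q i] that is a
    neighbourhood of [x]. *)
Lemma hump_locally0 r : 0 < r -> (forall x, exists i, d x (q i) < r) ->
  forall x, exists N, \forall z \near x, forall n, (N <= n)%N -> hump r n z = 0.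
Proof.
move=> r0 q_dense x; have [i xi] := q_dense x; exists i.+1.
have /cvgrPdist_lt/(_ (r - d x (q i)))/= : {for x, continuous (fun y => d y (q i))}.
  exact: continuous_dist.
rewrite subr_gt0 => /(_ xi); apply: filterS => z.
rewrite ltr_norml => /andP[xz _] n ltin; apply: (hump_eq0 r0 ltin); lra.
Qed.

End humps_and_bumps.

(** * Quasi-regularity through countably many conditions *)

Section quasi_regular.
Variables (R : realType) (X : topologicalType) (T : X -> X).
Variables (d : X -> X -> R) (q : nat -> X).
Hypotheses (d_metric : is_metric d) (d_top : metrizes d).
Hypothesis d_complete :
  forall u : nat -> X, metric_cauchy d u -> exists l : X, u @ \oo --> l.
Hypothesis q_dense : forall (r : R) x, 0 < r -> exists i, d x (q i) < r.
Local Notation A := (birkhoff_average T).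
Local Notation rho m := ((2^-1 : R) ^+ m).

Let rho_gt0 m : 0 < rho m. Proof. by rewrite exprn_gt0// invr_gt0. Qed.

Let le_rho m n : (m <= n)%N -> rho n <= rho m.
Proof. by move=> mn; rewrite ler_wiXn2l// ?invr_ge0// invf_le1// ler1n. Qed.

Let rho_small (b : R) : 0 < b -> exists m, rho m < b.
Proof.
move=> b0; have : (fun m => rho m) @ \oo --> (0 : R).
  by apply: cvg_expr; rewrite ger0_norm ?invr_ge0// invf_lt1// ltr1n.
move=> /cvgrPdist_lt/(_ _ b0)[m _ /(_ m (leqnn m))] /=.
by rewrite sub0r normrN ger0_norm ?(ltW (rho_gt0 m))//; exists m.
Qed.

Let sum_rho M L : \sum_(s < L) rho (M + s) <= 2 * rho M.
Proof.
suff -> : \sum_(s < L) rho (M + s) = 2 * rho M - 2 * rho (M + L).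
  by rewrite gerBl mulr_ge0// ltW.
elim: L => [|L IH]; first by rewrite big_ord0 addn0 subrr.
rewrite big_ord_recr/= IH addnS exprS; lra.
Qed.

Lemma cvgn_birkhoff_tight x (N : nat -> nat) (phi : X -> R) :
  (forall m k, A (hump d q (rho m) (N m)) k x <= rho m) ->
  (forall m n i, cvgn (fun k => A (bump d q (rho m) n i) k x)) ->
  bounded_fun phi -> continuous phi -> cvgn (fun k => A phi k x).
Proof.
move=> tight cvg_bump /bounded_fun_ex[c c0 phic] phi_cont.
have approx (e : R) : 0 < e -> exists m, forall k,
    `|A phi k x -
      A (fun y => \sum_(i < N m) phi (q i) * bump d q (rho m) (N m) i y) k x| <= e.
  move=> e0; have e20 : 0 < e / 2 by rewrite divr_gt0.
  (* Points outside [K] below cost at most [2 * c] times a total mass [2 * rho M], which this choice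
     keeps below [e / 2]. *)
  have [M HM] : exists M, rho M < e / (8 * c).
    by apply: rho_small; rewrite divr_gt0// mulr_gt0.
  have a0 (b : R) : 0 < b ->
      exists m0, forall m, (m0 <= m)%N -> 2 * rho (M + m) < b.
    move=> b0; have [m0 Hm0] := rho_small (divr_gt0 b0 (ltr0n R 2)).
    exists m0 => m m0m; rewrite mulrC -ltr_pdivlMr//; apply: le_lt_trans Hm0.
    by apply: le_rho; rewrite (leq_trans m0m)// leq_addl.
  have [r r0 Hr] :=
    uniform_modulus d_metric d_top d_complete phi_cont e20 q (fun m => N (M + m)%N) a0.
  (* Bumps at scale [m] live within [3 * rho m < r] of their centres, and [m = M + m1] is among the
     scales that [K] controls. *)
  have [m1 Hm1] := rho_small (divr_gt0 r0 (ltr0n R 3)).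
  pose m := (M + m1)%N; pose psi y :=
    \sum_(i < N m) phi (q i) * bump d q (rho m) (N m) i y.
  have psi_le y : `|psi y| <= c.
    apply: le_trans (ler_norm_sum _ _ _) _.
    apply: (@le_trans _ _ (c * \sum_(i < N m) bump d q (rho m) (N m) i y)).
      rewrite mulr_sumr ler_sum// => i _; rewrite normrM.
      by rewrite (ger0_norm (bump_ge0 _ _ _ _ _ _))// ler_wpM2r// bump_ge0.
    by rewrite ler_piMr// ?sum_bump_le1// ltW.
  pose K y := forall s, exists2 i, (i < N (M + s))%N & d y (q i) < 2 * rho (M + s).
  (* On [K] the bumps sum to 1, so the difference is a convex combination of [phi y - phi (q i)]
     over centres within [r] of [y]. *)
  have psi_close y : K y -> `|phi y - psi y| <= e / 2.
    move=> Ky; have sum1 := sum_bump_eq1 (rho_gt0 m) (Ky m1).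
    have scale_sum b : b = \sum_(i < N m) b * bump d q (rho m) (N m) i y.
      by rewrite -mulr_sumr sum1 mulr1.
    rewrite [phi y]scale_sum /psi -sumrB [leRHS]scale_sum.
    apply: le_trans (ler_norm_sum _ _ _) _; apply: ler_sum => i _.
    rewrite -mulrBl normrM (ger0_norm (bump_ge0 _ _ _ _ _ _))//.
    have [->|] := eqVneq (bump d q (rho m) (N m) i y) 0; first by rewrite !mulr0.
    move=> /bump_neq0 near_i; rewrite ler_wpM2r ?bump_ge0//; apply: Hr => //.
    apply: lt_le_trans near_i _; rewrite mulrC -ler_pdivlMr//.
    by apply: le_trans (ltW Hm1); apply: le_rho; rewrite leq_addl.
  exists m => k; rewrite -birkhoffB -/psi.
  apply: le_trans (ler_norm_birkhoff _ _ _ _) _.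
  (* A point outside [K] is far from all centres at some scale, where the hump is 1; finitely many
     scales suffice before time [k], so [H] dominates the indicator of the complement of [K]
     there. *)
  have /choice[s Hs] j : exists s, ~ K (iter j T x) ->
      hump d q (rho (M + s)) (N (M + s)%N) (iter j T x) = 1.
    have [|nK] := pselect (K (iter j T x)); first by exists 0%N.
    have [s Ks] := (not_existsP _).2 (fun H => nK (fun s => contrapT (H s))).
    exists s => _; apply: hump_eq1 => // i iN; rewrite leNgt; apply/negP => close.
    by apply: Ks; exists i.
  pose L := (\max_(j < k) s j).+1.
  pose H y := \sum_(t < L) hump d q (rho (M + t)) (N (M + t)%N) y.
  apply: (@le_trans _ _ (A (fun y => e / 2 + 2 * c * H y) k x)).
    apply: ler_birkhoff => j jk; set y := iter j T x.
    have H0 : 0 <= H y by apply: sumr_ge0 => t _; exact: hump_ge0.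
    have [Ky|nK] := pselect (K y).
      apply: le_trans (psi_close y Ky) _.
      by rewrite lerDl mulr_ge0// mulr_ge0// ltW.
    have sL : (s j < L)%N by rewrite ltnS (leq_bigmax (Ordinal jk)).
    have H1 : 1 <= H y.
      rewrite /H (bigD1 (Ordinal sL))//= Hs// lerDl.
      by apply: sumr_ge0 => t _; exact: hump_ge0.
    have : 2 * c * 1 <= 2 * c * H y by rewrite ler_pM2l// mulr_gt0.
    have := ler_normB (phi y) (psi y); have := psi_le y; have := phic y; lra.
  rewrite birkhoffD (birkhoffZ T (2 * c) H).
  have : A (fun=> e / 2) k x <= e / 2 by apply: birkhoff_le_cst => //; exact: ltW.
  have : A H k x <= 2 * rho M.
    have -> : A H k x = \sum_(t < L) A (hump d q (rho (M + t)) (N (M + t)%N)) k x.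
      exact: birkhoff_sum.
    by apply: le_trans (sum_rho M L); apply: ler_sum => t _; exact: tight.
  rewrite -(ler_pM2l (mulr_gt0 (ltr0n R 2) c0)).
  move: HM; rewrite ltr_pdivlMr ?mulr_gt0// => HM.
  lra.
apply/cvgn_cauchyP => e e0.
have [m Hm] := approx (e / 3) (divr_gt0 e0 (ltr0n R 3)).
pose psi k := A (fun y => \sum_(i < N m) phi (q i) * bump d q (rho m) (N m) i y) k x.
have : cvgn psi.
  apply/cvg_ex; exists (\sum_(i < N m)
    phi (q i) * limn (fun k => A (bump d q (rho m) (N m) i) k x)).
  have -> : psi = fun k => \sum_(i < N m) phi (q i) * A (bump d q (rho m) (N m) i) k x.
    apply/funext => k; rewrite /psi birkhoff_sum; apply: eq_bigr => i _.
    by rewrite birkhoffZ.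
  apply: (@cvg_big R _ +%R 0 xpredT) => [xy|i _]; first exact: add_continuous.
  by apply: cvgM; [exact: cvg_cst|exact: cvg_bump].
move=> /cvgn_cauchyP/(_ _ (divr_gt0 e0 (ltr0n R 3)))[K HK].
exists K => k l Kk Kl.
have := HK _ _ Kk Kl; have := Hm k; have := Hm l; rewrite -!/(psi _).
by rewrite !ler_norml => /andP[? ?] /andP[? ?] /andP[? ?]; apply/andP; split; lra.
Qed.

Lemma quasi_regularP x : quasi_regular_set R T x <->
  (forall m, exists n, forall k, A (hump d q (rho m) n) k x <= rho m) /\
  (forall m n i, cvgn (fun k => A (bump d q (rho m) n i) k x)).
Proof.
split=> [Qx|[/choice[N tight] cvg_bump] [phi [bphi cphi]]]; last first.
  by apply; exact: cvgn_birkhoff_tight tight cvg_bump bphi cphi.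
have cvgA (phi : X -> R) : bounded_fun phi -> continuous phi -> cvgn (fun k => A phi k x).
  by move=> bphi cphi; apply: contrapT => ncvg; apply: Qx; exists phi.
split=> [m|m n i].
  apply: no_escaping_mass => //.
  - by move=> n; exact: continuous_hump.
  - by move=> n y; exact: hump_le1.
  - by move=> i n y; exact: le_hump.
  - by apply: hump_locally0 => // y; exact: q_dense.
apply: cvgA; last exact: continuous_bump.
by apply: (@bounded_fun_le _ _ _ 3) => y; rewrite ger0_norm ?bump_ge0// bump_le3.
Qed.

End quasi_regular.

(** * Borel classes and sets of convergence *)

Section borel_classes.
Variables (R : realType) (X : topologicalType).

Lemma Fsigma_setC (S : set X) : Fsigma S -> Gdelta (~` S).
Proof.
move=> [F Fc ->]; exists (fun i => ~` F i) => [i|]; last by rewrite setC_bigcup.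
by rewrite openC.
Qed.

Lemma Pi03_setC (S : set X) : Pi03 S -> Sigma03 (~` S).
Proof.
move=> [F FS ->]; exists (fun i => ~` F i) => [i|]; last by rewrite setC_bigcap.
exact: Fsigma_setC.
Qed.

Lemma bigcap_Fsigma_Pi03 (I : countType) (F : I -> set X) :
  (forall i, Fsigma (F i)) -> Pi03 (\bigcap_i F i).
Proof.
(* Numbers that code no index contribute the whole space. *)
move=> FS; exists (fun n => if unpickle n is Some i then F i else setT) => [n|].
  by case: unpickle => [i|]; [exact: FS|exact/closed_Fsigma/closedT].
apply/seteqP; split=> [x Fx n _|x Fx i _]; first by case: unpickle => // i; exact: Fx.
by have := Fx (pickle i) Logic.I; rewrite /= pickleK.
Qed.

Lemma bigcap_Pi03 (I : countType) (F : I -> set X) :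
  (forall i, Pi03 (F i)) -> Pi03 (\bigcap_i F i).
Proof.
move=> FP; have /choice[G GP] i : exists G : nat -> set X,
    (forall n, Fsigma (G n)) /\ F i = \bigcap_n G n.
  by have [G GS FG] := FP i; exists G.
have -> : \bigcap_i F i = \bigcap_(p : I * nat) G p.1 p.2.
  apply/seteqP; split=> [x Fx [i n] _|x Gx i _].
    by have := Fx i Logic.I; rewrite (GP i).2 => /(_ n); exact.
  by rewrite (GP i).2 => n _; exact: (Gx (i, n)).
by apply: bigcap_Fsigma_Pi03 => -[i n]; exact: (GP i).1.
Qed.

Lemma Pi03_setI (S S' : set X) : Pi03 S -> Pi03 S' -> Pi03 (S `&` S').
Proof.
move=> PS PS'; have -> : S `&` S' = \bigcap_(b : bool) (if b then S else S').
  apply/seteqP; split=> [x [Sx S'x] [] _//|x SS'].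
  by split; [exact: (SS' true)|exact: (SS' false)].
by apply: bigcap_Pi03 => -[].
Qed.

Lemma closed_le_continuous (f : X -> R) (c : R) :
  continuous f -> closed [set x | f x <= c].
Proof.
by move=> /continuous_closedP/(_ [set y | y <= c]); apply; exact: closed_le.
Qed.

(** Cauchy criterion with tolerances [1 / (p + 1)]: for fixed [p] and [N] it is a closed
    condition. *)
Lemma Pi03_cvgn (u : nat -> X -> R) : (forall k, continuous (u k)) ->
  Pi03 [set x | cvgn (fun k => u k x)].
Proof.
move=> u_cont; have -> : [set x | cvgn (fun k => u k x)] =
    \bigcap_p \bigcup_N \bigcap_(kl in [set kl | (N <= kl.1)%N /\ (N <= kl.2)%N])
      [set x | `|u kl.1 x - u kl.2 x| <= p.+1%:R^-1].
  apply/seteqP; split=> [x /cvgn_cauchyP cx p _|x cx].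
    have [|N HN] := cx p.+1%:R^-1; first by rewrite invr_gt0.
    by exists N => // -[k l] [Nk Nl]; exact: HN.
  apply/cvgn_cauchyP => e e0; pose p := Num.bound e^-1.
  have [N _ HN] := cx p Logic.I; exists N => k l Nk Nl.
  have /= := HN (k, l) (conj Nk Nl); move/le_trans; apply.
  rewrite invf_ple ?posrE//; apply: ltW; apply: lt_trans (_ : p%:R < _).
    by apply: archi_boundP; rewrite invr_ge0 ltW.
  by rewrite ltr_nat.
apply: bigcap_Fsigma_Pi03 => p; exists (fun N =>
  \bigcap_(kl in [set kl | (N <= kl.1)%N /\ (N <= kl.2)%N])
    [set x | `|u kl.1 x - u kl.2 x| <= p.+1%:R^-1]) => // N.
apply: closed_bigI => -[k l] _ /=; apply: closed_le_continuous => x.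
by apply: cvg_norm; apply: cvgB; exact: u_cont.
Qed.

End borel_classes.

(** * Complexity of the irregular and quasi-regular sets *)

Lemma separable_dense_seq (X : topologicalType) (x0 : X) : separable X ->
  exists q : nat -> X, dense (range q).
Proof.
move=> [D /countable_injP[f f_inj] D_dense].
(* Numbers that code no point of [D] are sent to [x0]; the range still contains [D]. *)
exists (fun n => xget x0 [set y | D y /\ f y = n]) => O O0 oO.
have [y [Oy Dy]] := D_dense O O0 oO; exists y; split=> //.
exists (f y) => //; case: xgetP => [z _ [Dz fzy]|/(_ y)[]//].
by apply: f_inj; rewrite ?inE.
Qed.

Lemma Pi03_quasi_regular (R : realType) (X : topologicalType) (T : X -> X) :
  polish_space R X -> continuous T -> Pi03 (quasi_regular_set R T).
Proof.
move=> [X_sep [d [d_metric d_top d_complete]]] T_cont.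
(* An empty space carries no sequence [q] and is treated apart. *)
have [[x0 _]|X_empty] := pselect ([set: X] !=set0); last first.
  exists (fun=> setT) => [_|]; first exact/closed_Fsigma/closedT.
  by apply/seteqP; split=> x; exfalso; apply: X_empty; exists x.
have [q q_dense] := separable_dense_seq x0 X_sep.
have q_dense_dist (r : R) x : 0 < r -> exists i, d x (q i) < r.
  move=> r0; have /q_dense : (interior [set y | d x y < r]) !=set0.
    by exists x; apply/(metrizes_nbhsP d_metric d_top); exists r.
  by case/(_ (@open_interior _ _)) => y [/interior_subset /= xy [i _ qy]]; exists i; rewrite qy.
pose A := birkhoff_average (R := R) T; pose rho m : R := 2^-1 ^+ m.
have rho_gt0 m : 0 < rho m by rewrite exprn_gt0// invr_gt0.
(* For fixed [m] and [n] the tightness condition is closed, as the averages are continuous in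
   [x]. *)
have -> : quasi_regular_set R T =
    (\bigcap_m \bigcup_n \bigcap_k [set x | A (hump d q (rho m) n) k x <= rho m]) `&`
    \bigcap_(mni : nat * nat * nat)
      [set x | cvgn (fun k => A (bump d q (rho mni.1.1) mni.1.2 mni.2) k x)].
  apply/seteqP; split=> x.
    move=> /(quasi_regularP T d_metric d_top d_complete q_dense_dist)[tight cvg_bump].
    split=> [m _|[[m n] i] _]; last exact: cvg_bump.
    by have [n Hn] := tight m; exists n => // k _; exact: Hn.
  move=> [tight cvg_bump].
  apply/(quasi_regularP T d_metric d_top d_complete q_dense_dist); split=> [m|m n i].
    by have [n _ Hn] := tight m Logic.I; exists n => k; exact: Hn.
  exact: (cvg_bump (m, n, i)).
apply: Pi03_setI.
  apply: bigcap_Fsigma_Pi03 => m.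
  exists (fun n => \bigcap_k [set x | A (hump d q (rho m) n) k x <= rho m]) => // n.
  apply: closed_bigI => k _; apply: closed_le_continuous.
  by apply: continuous_birkhoff => //; exact: continuous_hump.
apply: bigcap_Pi03 => -[[m n] i]; apply: Pi03_cvgn => k.
by apply: continuous_birkhoff => //; exact: continuous_bump.
Qed.

Theorem fact15 (R : realType) (X : topologicalType) (T : X -> X)
    (hX : polish_space R X) (hT : continuous T) :
  Sigma03 (irregular_set R T) /\ Pi03 (quasi_regular_set R T).
Proof.
have PQ := Pi03_quasi_regular hX hT; split=> //.
by rewrite -[irregular_set R T]setCK; exact: Pi03_setC.
Qed.
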